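(* Let $A\in\mathbb{R}^{3\times 3}$ be full-capacity, and let $\tau$ be an assigned support map for $A$. Then, up to a simultaneous permutation of the indices, the detailed assigned profile of $(A,\tau)$ is one of the following three (listed with its aggregate profile $(S_1,S_2,S_3)$): - aggregate profile $(1,5,3)$, detailed profile $(1,0,0;1,2,2;3)$; - aggregate profile $(2,4,3)$, detailed profile $(1,1,0;1,2,1;3)$; - aggregate profile $(2,5,2)$, detailed profile $(1,1,0;1,2,2;2)$. Here ''up to a simultaneous permutation of the indices'' means that there is a permutation $\sigma$ of $\{1,2,3\}$ such that $(m_{\sigma(1)},m_{\sigma(2)},m_{\sigma(3)};m_{\sigma(1)\sigma(2)},m_{\sigma(1)\sigma(3)},m_{\sigma(2)\sigma(3)};m_{123})$ is one of the three displayed detailed profiles.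
   Context: Vector inequalities are componentwise ($u>0$ means all components are positive). For $A\in\mathbb{R}^{n\times n}$, a real number $\lambda$ is a Pareto eigenvalue of $A$ if there is $x\in\mathbb{R}^n\setminus\{0\}$ with $x\ge 0$, $Ax-\lambda x\ge 0$ and $\langle x,Ax-\lambda x\rangle=0$. The set of Pareto eigenvalues is $\Pi(A)$. The Pareto capacity of order $n$ is $c_n:=\max_{A\in\mathbb{R}^{n\times n}}|\Pi(A)|$, and $A\in\mathbb{R}^{n\times n}$ is full-capacity if $|\Pi(A)|=c_n$. A support is a nonempty subset $J\subseteq\{1,\dots,n\}$, with complement $J^{\mathrm c}$; $A_J$ is the principal submatrix indexed by $J$ and $A_{J^{\mathrm c},J}$ is the submatrix with rows in $J^{\mathrm c}$ and columns in $J$. The support $J$ produces $\lambda\in\mathbb{R}$ if there is $u\in\mathbb{R}^{|J|}$ with $A_Ju=\lambda u$, $u>0$, $A_{J^{\mathrm c},J}u\ge 0$. The set of values produced by $J$ is $\Pi_J(A)$; one has $\Pi(A)=\bigcup_J\Pi_J(A)$ (the same value may be produced by several supports). An assigned support map for $A$ is a map $\tau$ from $\Pi(A)$ to the set of supports such that $\lambda\in\Pi_{\tau(\lambda)}(A)$ for every $\lambda\in\Pi(A)$. Put $m_J:=|\{\lambda\in\Pi(A):\tau(\lambda)=J\}|$ and $S_k:=\sum_{|J|=k}m_J$. For $n=3$ write $m_i=m_{\{i\}}$, $m_{ij}=m_{ji}=m_{\{i,j\}}$, $m_{123}=m_{\{1,2,3\}}$. The detailed assigned profile is $(m_1,m_2,m_3;m_{12},m_{13},m_{23};m_{123})$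 and the aggregate assigned profile is $(S_1,S_2,S_3)$. *)

(* Defs.v *)
From HB Require Import structures.
From mathcomp Require Import all_boot all_order all_algebra all_fingroup.
From mathcomp Require Import finmap.
From mathcomp Require Import all_classical all_reals.

Set Implicit Arguments.
Unset Strict Implicit.
Unset Printing Implicit Defensive.

Import Order.TTheory GRing.Theory Num.Theory.

Local Open Scope classical_set_scope.
Local Open Scope card_scope.
Local Open Scope ring_scope.

Section Pareto.
Variables (R : realType) (n : nat).
Implicit Types (A : 'M[R]_n) (J : {set 'I_n}) (tau : R -> {set 'I_n}).

Definition is_pareto_eigenvalue A (lambda : R) : Prop :=
  exists x : 'cV[R]_n,
    [/\ x != 0,
        forall i, 0 <= x i 0,
        forall i, 0 <= (A *m x - lambda *: x) i 0 &
        \sum_i x i 0 * (A *m x - lambda *: x) i 0 = 0].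

Definition pareto_spectrum A : set R := [set l | is_pareto_eigenvalue A l].

Definition is_pareto_capacity (c : nat) : Prop :=
  (exists A : 'M[R]_n, pareto_spectrum A #= `I_c) /\
  (forall A : 'M[R]_n, pareto_spectrum A #<= `I_c).

Definition full_capacity A : Prop :=
  exists2 c : nat, is_pareto_capacity c & pareto_spectrum A #= `I_c.

(* Rows in I and columns in J, both listed in increasing order. *)
Definition submatrix (I J : {set 'I_n}) A : 'M[R]_(#|I|, #|J|) :=
  mxsub (@enum_val _ (mem I)) (@enum_val _ (mem J)) A.

(* Only meaningful for nonempty J: the empty set would produce every value. *)
Definition produces A J (lambda : R) : Prop :=
  exists u : 'cV[R]_#|J|,
    [/\ submatrix J J A *m u = lambda *: u,
        forall i, 0 < u i 0 &
        forall i, 0 <= (submatrix (~: J) J A *m u) i 0].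

(* The map is defined on the whole of R, but it is constrained and used only on
   the Pareto spectrum of A. *)
Definition assigned_support_map A tau : Prop :=
  forall lambda, pareto_spectrum A lambda ->
    tau lambda != finset.set0 /\ produces A (tau lambda) lambda.

(* [fset_set] sends infinite sets to the empty one; the spectrum of a
   full-capacity matrix is finite, so this is the actual cardinal there. *)
Definition multiplicity A tau J : nat :=
  #|` fset_set [set l | pareto_spectrum A l /\ tau l = J]|%fset.

Definition level_sum A tau (k : nat) : nat :=
  (\sum_(J : {set 'I_n} | #|J| == k) multiplicity A tau J)%N.

End Pareto.

Section OrderThree.
Variables (R : realType) (A : 'M[R]_3) (tau : R -> {set 'I_3}).

Definition aggregate_profile : nat * nat * nat :=
  (level_sum A tau 1, level_sum A tau 2, level_sum A tau 3).

(* (m_s1, m_s2, m_s3; m_s1s2, m_s1s3, m_s2s3; m_123), the indices 1, 2, 3 being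
   represented by 0, 1, 2 : 'I_3. *)
Definition detailed_profile (s : 'S_3) :
    (nat * nat * nat) * (nat * nat * nat) * nat :=
  let m := multiplicity A tau in
  let i := s (inord 0) in let j := s (inord 1) in let k := s (inord 2) in
  ((m [set i]%SET, m [set j]%SET, m [set k]%SET),
   (m [set i; j]%SET, m [set i; k]%SET, m [set j; k]%SET),
   m [set: 'I_3]%SET).

End OrderThree.

(* Main.v *)
Require Import Defs.
From mathcomp Require Import all_boot all_order all_algebra all_fingroup.
From mathcomp Require Import finmap.
From mathcomp Require Import all_classical all_reals.
From mathcomp Require Import ring lra zify.

(* If a pair {i, j} produces two values, the two positive ratios of coordinates
   are roots of a quadratic, so a_ij and a_ji have opposite signs and the larger
   of the diagonal entries a_ii and a_jj lies in the row of the negative one.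
   With the sign conditions carried by the other supports, the only profiles of
   total at least 9 that survive are the three of the theorem and
   (1,1,0; *,2,2; 3). In the latter case, write al = a_11 - a_13 a_21 / a_23 and
   be = a_22 - a_23 a_12 / a_13. If al <> be, an eigenvalue with a positive
   eigenvector cannot lie between al and be, whereas the pairs {1, 3} and {2, 3}
   force the characteristic polynomial to have opposite (weak) signs at al and
   be: some eigenvalue lies between them, so {1, 2, 3} produces at most two
   values. If al = be, either al is already produced by {1, 3} or the
   eigenvalues with a positive eigenvector are roots of a quadratic.
   A matrix with nine Pareto eigenvalues shows that totals are at least 9. *)

Set Implicit Arguments.
Unset Strict Implicit.

Import Order.TTheory GRing.Theory Num.Theory.

(** * Algebra of 2x2 and 3x3 eigenvalue equations over a real field *)

Section RealFieldLemmas.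
Local Open Scope ring_scope.
Variable R : realFieldType.
Implicit Types a b c d e f g l m n q s t v w x y al be : R.
(** Eliminating the eigenvalue for the eigenvector (1, t) of [[a, b], [c, d]] leaves b t^2 + (a - d)
    t - c = 0. Distinct eigenvalues have distinct ratios t, so the conclusions are Vieta's
    formulas. *)
Lemma two_ratios a b c d t1 t2 l1 l2 : 0 < t1 -> 0 < t2 -> l1 != l2 ->
  a + b * t1 = l1 -> c + d * t1 = l1 * t1 ->
  a + b * t2 = l2 -> c + d * t2 = l2 * t2 ->
  [/\ b != 0, b * (t1 + t2) = d - a & b * (t1 * t2) = - c].
Proof.
move=> t1_gt0 t2_gt0 l12 e1 f1 e2 f2; subst l1 l2.
have t12 : t1 - t2 != 0 by apply: contraNneq l12 => /subr0_eq ->.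
have sumE : b * (t1 + t2) = d - a.
  by apply: (mulIf t12); lra.
split=> //; first by apply: contraNneq l12 => ->; rewrite !mul0r.
have -> : b * (t1 * t2) = b * (t1 + t2) * t1 - b * t1 * t1 by ring.
by rewrite sumE; lra.
Qed.

Lemma two_ratios_sign a b c d t1 t2 l1 l2 : 0 < t1 -> 0 < t2 -> l1 != l2 ->
  a + b * t1 = l1 -> c + d * t1 = l1 * t1 ->
  a + b * t2 = l2 -> c + d * t2 = l2 * t2 ->
  [/\ 0 < b, c < 0 & a < d] \/ [/\ b < 0, 0 < c & d < a].
Proof.
move=> t1_gt0 t2_gt0 l12 e1 f1 e2 f2.
have [b0 sE pE] := two_ratios t1_gt0 t2_gt0 l12 e1 f1 e2 f2.
have s_gt0 : 0 < t1 + t2 by rewrite addr_gt0.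
have p_gt0 : 0 < t1 * t2 by rewrite mulr_gt0.
case: (ltrgtP b 0) b0 => // b_sg _; [right|left]; split=> //.
- by rewrite -oppr_lt0 -pE nmulr_rlt0.
- by rewrite -subr_lt0 -sE nmulr_rlt0.
- by rewrite -oppr_gt0 -pE mulr_gt0.
- by rewrite -subr_gt0 -sE mulr_gt0.
Qed.

Lemma monic_cubic_factor e f g l1 l2 l3
    (chi := fun x => x ^+ 3 + e * x ^+ 2 + f * x + g) :
  l1 < l2 -> l2 < l3 -> chi l1 = 0 -> chi l2 = 0 -> chi l3 = 0 ->
  forall x, chi x = (x - l1) * (x - l2) * (x - l3).
Proof.
rewrite {}/chi => l12 l23 r1 r2 r3 x.
have n12 : l1 - l2 != 0 by rewrite subr_eq0 lt_eqF.
have n23 : l2 - l3 != 0 by rewrite subr_eq0 lt_eqF.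
have n13 : l1 - l3 != 0 by rewrite subr_eq0 lt_eqF // (lt_trans l12).
(* [q12] and [q23] are first divided differences of [chi]; their own difference, divided by l1 - l3,
   gives the sum of the roots. *)
have q12 : l1 ^+ 2 + l1 * l2 + l2 ^+ 2 + e * (l1 + l2) + f = 0.
  by apply: (mulIf n12); lra.
have q23 : l2 ^+ 2 + l2 * l3 + l3 ^+ 2 + e * (l2 + l3) + f = 0.
  by apply: (mulIf n23); lra.
have eE : e = - (l1 + l2 + l3).
  by apply: (mulIf n13); lra.
have fE : f = l1 * l2 + l1 * l3 + l2 * l3 by move: q12; rewrite eE; lra.
have gE : g = - (l1 * l2 * l3) by move: r1; rewrite eE fE; lra.
by rewrite eE fE gE; ring.
Qed.

(* The matrix is parametrized so that its rows are (al + q m, q n, - q),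
   (s m, be + s n, - s) and (v, w, c); its positive eigenvectors are scaled to
   (x, y, 1). *)
Definition eigen_data al be q s m n v w c l :=
  exists x y, [/\ 0 < x, 0 < y,
    (al - l) * x = q * (1 - m * x - n * y),
    (be - l) * y = s * (1 - m * x - n * y) &
    v * x + w * y = l - c].

Lemma eigen_dataC al be q s m n v w c l :
  eigen_data al be q s m n v w c l -> eigen_data be al s q n m w v c l.
Proof.
by move=> [x [y [x0 y0 ex ey ez]]]; exists y, x; split=> //;
  rewrite ?ex ?ey -?ez; ring.
Qed.

(** The left-hand side is det(l I - M) for the parametrized matrix M. It is rewritten as a
    combination of the first two eigenvector equations with coefficients v and w. *)
Lemma eigen_data_char al be q s m n v w c l :
  eigen_data al be q s m n v w c l ->
  (l - c) * ((al - l) * (be - l) + m * q * (be - l) + n * s * (al - l))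
    - v * q * (be - l) - w * s * (al - l) = 0.
Proof.
move=> [x [y [x0 y0 ex ey ez]]].
rewrite -ez.
have -> : (v * x + w * y) *
    ((al - l) * (be - l) + m * q * (be - l) + n * s * (al - l)) -
    v * q * (be - l) - w * s * (al - l) =
  v * ((be - l) * ((al - l) * x - q * (1 - m * x - n * y))
        + n * s * ((al - l) * x) - n * q * ((be - l) * y)) +
  w * ((al - l) * ((be - l) * y - s * (1 - m * x - n * y))
        + m * q * ((be - l) * y) - m * s * ((al - l) * x)) by ring.
by rewrite ex ey; ring.
Qed.

(* Both (al - l) x / q and (be - l) y / s equal 1 - m x - n y. *)
Lemma eigen_data_outside al be q s m n v w c l : 0 < q -> 0 < s -> al < be ->
  eigen_data al be q s m n v w c l -> 0 < (al - l) * (be - l).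
Proof.
move=> q0 s0 ab [x [y [x0 y0 ex ey ez]]].
set e := 1 - m * x - n * y in ex ey *.
have e0 : e != 0.
  apply/eqP => e0; move: ex ey; rewrite e0 !mulr0 => /eqP + /eqP.
  rewrite !mulf_eq0 (gt_eqF x0) (gt_eqF y0) !orbF !subr_eq0.
  by move=> /eqP al_l /eqP be_l; move: ab; rewrite al_l be_l ltxx.
have xy0 : 0 < x * y by rewrite mulr_gt0.
rewrite -(pmulr_lgt0 _ xy0).
have -> : (al - l) * (be - l) * (x * y) = q * s * e ^+ 2.
  have -> : (al - l) * (be - l) * (x * y) =
      ((al - l) * x) * ((be - l) * y) by ring.
  by rewrite ex ey; ring.
by rewrite pmulr_rgt0; [rewrite exprn_even_gt0 | exact: mulr_gt0].
Qed.

(** The product of the three positive numbers (al - li)(be - li) is chi(al) chi(be) for the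
    characteristic polynomial chi, whereas the bounds on v and w give chi(al) <= 0 <= chi(be). *)
Lemma no_three_eigen_data_lt al be q s m n v w c l1 l2 l3 : 0 < q -> 0 < s ->
  al < be -> l1 < l2 -> l2 < l3 ->
  eigen_data al be q s m n v w c l1 -> eigen_data al be q s m n v w c l2 ->
  eigen_data al be q s m n v w c l3 ->
  m * (al - c) <= v -> n * (be - c) <= w -> False.
Proof.
move=> q0 s0 ab l12 l23 e1 e2 e3 hv hw.
have := eigen_data_outside q0 s0 ab e1.
have := eigen_data_outside q0 s0 ab e2.
have := eigen_data_outside q0 s0 ab e3.
pose chi x := (x - c) *
    ((al - x) * (be - x) + m * q * (be - x) + n * s * (al - x)) -
    v * q * (be - x) - w * s * (al - x).
pose e := - (al + be + c + m * q + n * s).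
pose f := al * be + m * q * be + n * s * al + c * (al + be + m * q + n * s)
  + v * q + w * s.
pose g := - c * (al * be + m * q * be + n * s * al) - v * q * be - w * s * al.
have chiE x : chi x = x ^+ 3 + e * x ^+ 2 + f * x + g.
  by rewrite /chi /e /f /g; ring.
have roots x : chi x = (x - l1) * (x - l2) * (x - l3).
  rewrite chiE; apply: monic_cubic_factor => //.
  - by rewrite -chiE; exact: eigen_data_char e1.
  - by rewrite -chiE; exact: eigen_data_char e2.
  - by rewrite -chiE; exact: eigen_data_char e3.
have chi_al : chi al <= 0.
  have -> : chi al = - (q * (be - al) * (v - m * (al - c))).
    by rewrite /chi; ring.
  by rewrite oppr_le0 !mulr_ge0 ?subr_ge0 // ltW.
have chi_be : 0 <= chi be.
  have -> : chi be = s * (be - al) * (w - n * (be - c)) by rewrite /chi; ring.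
  by rewrite !mulr_ge0 ?subr_ge0 // ltW.
move=> p3 p2 p1; have := mulr_gt0 (mulr_gt0 p1 p2) p3.
have -> : (al - l1) * (be - l1) * ((al - l2) * (be - l2)) *
   ((al - l3) * (be - l3)) = chi al * chi be by rewrite !roots; ring.
by rewrite ltNge mulr_le0_ge0.
Qed.

(** When al = be, an eigenvalue other than al forces (x, y) to be proportional to (q, s); the first
    and third rows then give a quadratic equation in l. *)
Lemma eigen_data_quadratic al q s m n v w c l : 0 < q -> l != al ->
  eigen_data al al q s m n v w c l ->
  (al - l + q * m + n * s) * (l - c) = q * v + w * s.
Proof.
move=> q0 lal [x [y [x0 y0 ex ey ez]]].
have al_l : al - l != 0 by rewrite subr_eq0 eq_sym.
have xy : s * x = q * y.
  apply: (mulfI al_l).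
  by have := congr1 ( *%R s) ex; have := congr1 ( *%R q) ey; rewrite /=; lra.
apply: (mulIf (lt0r_neq0 x0)); rewrite -ez.
have -> : (al - l + q * m + n * s) * (v * x + w * y) * x =
  ((al - l) * x + q * (m * x) + n * (s * x)) * (v * x + w * y) by ring.
rewrite ex xy.
have -> : (q * v + w * s) * x = q * (v * x) + w * (s * x) by ring.
by rewrite xy; ring.
Qed.

(** Three distinct values other than al would be roots of one quadratic. If m (al - c) < v, then al
    itself is impossible: it gives m x + n y = 1, hence al - c = v x + w y > (al - c)(m x + n y) =
    al - c. *)
Lemma no_three_eigen_data_eq al q s m n v w c l1 l2 l3 : 0 < q -> 0 < s ->
  l1 < l2 -> l2 < l3 ->
  eigen_data al al q s m n v w c l1 -> eigen_data al al q s m n v w c l2 ->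
  eigen_data al al q s m n v w c l3 ->
  n * (al - c) <= w ->
  m * (al - c) < v \/ al \notin [:: l1; l2; l3] -> False.
Proof.
move=> q0 s0 l12 l23 e1 e2 e3 hw hv.
have ne l : l \in [:: l1; l2; l3] ->
    eigen_data al al q s m n v w c l -> l != al.
  move=> l_in [x [y [x0 y0 ex ey ez]]]; apply: contraTneq l_in => lE.
  case: hv => [hv|]; last by rewrite lE.
  have exy : m * x + n * y = 1.
    move: ex; rewrite lE subrr mul0r => /esym/eqP.
    by rewrite mulf_eq0 (gt_eqF q0) /= => /eqP; lra.
  have : (v - m * (al - c)) * x > 0 by rewrite mulr_gt0 // subr_gt0.
  have : (w - n * (al - c)) * y >= 0 by rewrite mulr_ge0 ?subr_ge0 // ltW.
  have : (al - c) * (m * x + n * y) = al - c by rewrite exy mulr1.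
  by rewrite lE in ez; move=> h1 h2 h3; exfalso; lra.
have Q l : l \in [:: l1; l2; l3] -> eigen_data al al q s m n v w c l ->
    (al - l + q * m + n * s) * (l - c) = q * v + w * s.
  by move=> l_in e; apply: eigen_data_quadratic (e); rewrite // ne.
have := Q _ _ e1; have := Q _ _ e2; have := Q _ _ e3.
rewrite !inE !eqxx !orbT => /(_ isT) q3 /(_ isT) q2 /(_ isT) q1.
have n12 : l1 - l2 != 0 by rewrite subr_eq0 lt_eqF.
have n13 : l1 - l3 != 0 by rewrite subr_eq0 lt_eqF // (lt_trans l12).
(* Both l2 and l3 are the second root of the quadratic having the root l1. *)
have : l1 + l2 = c + al + q * m + n * s by apply: (mulIf n12); lra.
have : l1 + l3 = c + al + q * m + n * s by apply: (mulIf n13); lra.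
by lra.
Qed.

Lemma no_three_eigen_data al be q s m n v w c l1 l2 l3 : 0 < q -> 0 < s ->
  l1 < l2 -> l2 < l3 ->
  eigen_data al be q s m n v w c l1 -> eigen_data al be q s m n v w c l2 ->
  eigen_data al be q s m n v w c l3 ->
  m * (al - c) <= v -> n * (be - c) <= w ->
  m * (al - c) < v \/ al \notin [:: l1; l2; l3] -> False.
Proof.
move=> q0 s0 l12 l23 e1 e2 e3 hv hw hd.
case: (ltgtP al be) => ab.
- exact: (no_three_eigen_data_lt q0 s0 ab l12 l23 e1 e2 e3).
- by apply: (no_three_eigen_data_lt s0 q0 ab l12 l23
    _ _ _ hw hv); apply: eigen_dataC.
- rewrite -ab in e1 e2 e3 hw.
  exact: (no_three_eigen_data_eq q0 s0 l12 l23 e1 e2 e3).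
Qed.

End RealFieldLemmas.

(** * Supports and multiplicities in arbitrary order *)

Section AnyOrder.
Local Open Scope classical_set_scope.
Local Open Scope card_scope.
Local Open Scope ring_scope.
Variables (R : realType) (n : nat) (A : 'M[R]_n).
Implicit Types (J : {set 'I_n}) (l : R).

Lemma producesP J l : produces A J l -> exists x : 'I_n -> R,
  [/\ forall i, i \in J -> 0 < x i,
      forall i, i \in J -> \sum_(j in J) A i j * x j = l * x i &
      forall i, i \notin J -> 0 <= \sum_(j in J) A i j * x j].
Proof.
move=> [u [eig u_gt0 compl]].
(* At most one term is summed: [x] extends [u] by 0 outside J. *)
pose x i := \sum_(k < #|J| | enum_val k == i) u k 0.
have xE k : x (enum_val k) = u k 0.
  by rewrite /x (big_pred1 k) // => k'; rewrite (inj_eq enum_val_inj).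
have sumE i : \sum_(j in J) A i j * x j =
    \sum_(k < #|J|) A i (enum_val k) * u k 0.
  by rewrite big_enum_val; apply: eq_bigr => k _; rewrite xE.
exists x; split=> i iJ.
- by rewrite -(enum_rankK_in iJ iJ) xE.
- have /matrixP/(_ (enum_rank_in iJ i) 0) := eig.
  rewrite sumE !mxE -xE enum_rankK_in // => <-.
  by apply: eq_bigr => k _; rewrite !mxE enum_rankK_in.
- have iJc : i \in ~: J by rewrite inE.
  rewrite sumE; have := compl (enum_rank_in iJc i); rewrite mxE.
  by under eq_bigr do rewrite mxE enum_rankK_in //.
Qed.

(** The transpose appears because [eigenvalue] uses row vectors; an index in J makes the positive
    vector [u] nonzero. *)
Lemma produces_root J l : J != finset.set0 -> produces A J l ->
  root (char_poly (submatrix J J A)^T) l.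
Proof.
move=> /set0Pn[i iJ] [u [eig u_gt0 _]].
rewrite -eigenvalue_root_char; apply/eigenvalueP; exists u^T.
  by rewrite -trmx_mul eig linearZ.
apply/eqP => /matrixP/(_ 0 (enum_rank_in iJ i)); rewrite !mxE => u0.
by have := u_gt0 (enum_rank_in iJ i); rewrite u0 ltxx.
Qed.

Variable tau : R -> {set 'I_n}.
Hypothesis htau : assigned_support_map A tau.

Lemma multiplicityP J : exists s : seq R,
  [/\ sorted <%R s, size s = multiplicity A tau J &
      forall l, l \in s -> [/\ tau l = J, J != finset.set0 & produces A J l]].
Proof.
rewrite /multiplicity; set S := [set l | _].
exists (sort <=%R (fset_set S)); split.
- by rewrite sort_lt_sorted fset_uniq.
- by rewrite size_sort.
- move=> l; rewrite mem_sort.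
  (* If S is infinite, [fset_set S] is empty by convention and the claim is vacuous. *)
  have [fS|nfS] := pselect (finite_set S); last first.
    by rewrite /fset_set; case: pselect.
  by rewrite in_fset_set // => /set_mem[sl <-]; have [] := htau sl.
Qed.

Lemma multiplicity_le J : (multiplicity A tau J <= #|J|)%N.
Proof.
have [[|l s] [s_sorted <- sP]] := multiplicityP J; first by [].
have [_ J0 _] := sP l (mem_head l s).
rewrite -ltnS -(size_char_poly (submatrix J J A)^T).
apply: max_poly_roots; last exact: lt_sorted_uniq s_sorted.
  exact/monic_neq0/char_poly_monic.
by apply/allP => l' /sP[_ _]; exact: produces_root.
Qed.

(** The fibres of [tau] partition the finite spectrum. *)
Lemma sum_multiplicity c : pareto_spectrum A #= `I_c ->
  (\sum_J multiplicity A tau J = c)%N.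
Proof.
move=> Ac; rewrite -(card_fset_set Ac).
have fA : finite_set (pareto_spectrum A).
  by apply/finite_set_leP; exists c; move: Ac; rewrite card_eq_le => /andP[].
set F := fset_set _.
have mE J : multiplicity A tau J = (\sum_(l <- F | tau l == J) 1)%N.
  rewrite sum1_count -size_filter /multiplicity; set S := [set l | _].
  have fS : finite_set S by apply: sub_finite_set fA => l [].
  apply: perm_size; apply: uniq_perm; rewrite ?filter_uniq ?fset_uniq // => l.
  rewrite mem_filter in_fset_set // in_fset_set //.
  apply/idP/andP => [/set_mem[sl <-]|[/eqP tl /set_mem sl]].
    by split=> //; rewrite inE.
  by rewrite inE.
under eq_bigr do rewrite mE big_mkcond.
rewrite exchange_big /= -sum1_size; apply: eq_bigr => l _.
by rewrite -big_mkcond (big_pred1 (tau l)).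
Qed.

(* At the coordinate minimizing x / y, off-diagonal nonnegativity gives
   0 <= A (x - t y) = (l - m) x. *)
Lemma metzler_eigenvalue_le (x y : 'I_n -> R) l m (i0 : 'I_n) :
  (forall i j, i != j -> 0 <= A i j) ->
  (forall i, 0 < x i) -> (forall i, 0 < y i) ->
  (forall i, \sum_j A i j * x j = l * x i) ->
  (forall i, \sum_j A i j * y j = m * y i) -> m <= l.
Proof.
move=> off x_gt0 y_gt0 eigx eigy.
have [k _ k_min] := @arg_minP _ _ _ i0 xpredT (fun i => x i / y i) isT.
set t := x k / y k in k_min.
have tk : x k = t * y k by rewrite divfK // gt_eqF.
have : 0 <= \sum_j A k j * (x j - t * y j).
  apply: sumr_ge0 => j _; have [->|kj] := eqVneq j k.
    by rewrite tk subrr mulr0.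
  rewrite mulr_ge0 ?off // 1?eq_sym // subr_ge0 -ler_pdivlMr //.
  exact: k_min.
under eq_bigr do rewrite mulrBr mulrCA.
rewrite sumrB -mulr_sumr eigx eigy mulrCA -tk -mulrBl.
by rewrite pmulr_lge0 // subr_ge0.
Qed.

End AnyOrder.

(** * Order three: constraints relating singletons, pairs and the full support *)

Lemma uniq_swap12 (T : eqType) (x y z : T) :
  uniq [:: x; y; z] -> uniq [:: y; x; z].
Proof.
by rewrite (@perm_uniq _ _ [:: y; x; z]) // (perm_catCA [:: x] [:: y]).
Qed.

Lemma uniq_swap23 (T : eqType) (x y z : T) :
  uniq [:: x; y; z] -> uniq [:: x; z; y].
Proof.
by rewrite (@perm_uniq _ _ [:: x; z; y]) // perm_cons (perm_catC [:: y] [:: z]).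
Qed.

Lemma uniq_rot3 (T : eqType) (x y z : T) :
  uniq [:: x; y; z] -> uniq [:: y; z; x].
Proof. by rewrite -(rot_uniq 1). Qed.

Section OrderThree.
Local Open Scope ring_scope.

Lemma index_enum3 (i j k : 'I_3) : uniq [:: i; j; k] ->
  perm_eq (index_enum 'I_3) [:: i; j; k].
Proof.
move=> ijk; have sub : {subset [:: i; j; k] <= index_enum 'I_3}.
  by move=> x _; exact: mem_index_enum.
have [|_ ijkE] := uniq_min_size ijk sub.
  by rewrite -[index_enum _]enumT size_enum_ord.
by apply: uniq_perm => //; exact: index_enum_uniq.
Qed.

Lemma big_ord3 (T : Type) (idx : T) (op : Monoid.com_law idx) (i j k : 'I_3)
    (F : 'I_3 -> T) : uniq [:: i; j; k] ->
  \big[op/idx]_x F x = op (F i) (op (F j) (F k)).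
Proof.
move=> /index_enum3 ijk.
by rewrite (perm_big _ ijk) !big_cons big_nil Monoid.mulm1.
Qed.

Variables (R : realType) (A : 'M[R]_3).
Implicit Types (i j k : 'I_3) (l : R).

Lemma produces1P i l : produces A [set i]%SET l ->
  A i i = l /\ forall j, i != j -> 0 <= A j i.
Proof.
move=> /producesP[x [x_gt0 eig compl]].
have xi : 0 < x i by apply: x_gt0; rewrite set11.
split=> [|j ij].
- have := eig i; rewrite set11 big_set1 => /(_ isT) /mulIf -> //.
  by rewrite gt_eqF.
- have := compl j; rewrite big_set1 pmulr_lge0 // inE eq_sym; exact.
Qed.

Lemma produces2P i j k l : uniq [:: i; j; k] -> produces A [set i; j]%SET l ->
  exists t, [/\ 0 < t, A i i + A i j * t = l, A j i + A j j * t = l * t &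
    0 <= A k i + A k j * t].
Proof.
rewrite /= !inE negb_or andbT => /andP[/andP[ij ik] jk].
move=> /producesP[x [x_gt0 eig compl]].
have xi : 0 < x i by apply: x_gt0; rewrite set21.
have xj : 0 < x j by apply: x_gt0; rewrite set22.
have sE r : \sum_(c in [set i; j]%SET) A r c * x c =
    (A r i + A r j * (x j / x i)) * x i.
  by rewrite big_setU1 ?inE //= big_set1 mulrDl -mulrA divfK // gt_eqF.
exists (x j / x i); split; first by rewrite divr_gt0.
- have := eig i; rewrite set21 sE => /(_ isT) /mulIf -> //.
  by rewrite gt_eqF.
- have := eig j; rewrite set22 sE => /(_ isT) e.
  apply: (@mulIf _ (x i)); first by rewrite gt_eqF.
  by rewrite e -mulrA divfK // gt_eqF.
- have := compl k; rewrite sE pmulr_lge0 //; apply.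
  by rewrite !inE negb_or eq_sym ik eq_sym.
Qed.

Lemma produces3P i j k l : uniq [:: i; j; k] -> produces A [set: 'I_3]%SET l ->
  exists x y, [/\ 0 < x, 0 < y, A i i * x + A i j * y + A i k = l * x,
    A j i * x + A j j * y + A j k = l * y & A k i * x + A k j * y + A k k = l].
Proof.
move=> ijk /producesP[x [x_gt0 eig _]].
have {}x_gt0 r : 0 < x r by apply: x_gt0; rewrite inE.
have xk : x k != 0 by rewrite gt_eqF.
have {}eig r : A r i * x i + A r j * x j + A r k * x k = l * x r.
  rewrite -eig ?inE //; under [RHS]eq_bigl do rewrite inE.
  by rewrite (big_ord3 _ _ ijk) /= addrA.
exists (x i / x k), (x j / x k); rewrite !divr_gt0 //.
have sE r : A r i * (x i / x k) + A r j * (x j / x k) + A r k =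
    l * (x r / x k).
  by rewrite [RHS]mulrA -eig; field.
by split=> //; rewrite sE // divff // mulr1.
Qed.

Variable tau : R -> {set 'I_3}.
Hypothesis htau : assigned_support_map A tau.
Local Notation mult := (multiplicity A tau).

Lemma multiplicity_ge1 J : (1 <= mult J)%N -> exists l, produces A J l.
Proof.
have [[|l s] [_ <- sP]] := multiplicityP htau J; first by [].
by exists l; have [] := sP l (mem_head l s).
Qed.

Lemma multiplicity_ge2 J : (2 <= mult J)%N -> exists l1 l2,
  [/\ l1 < l2, tau l1 = J, tau l2 = J, produces A J l1 & produces A J l2].
Proof.
have [[|l1 [|l2 s]] [s_sorted <- sP]] := multiplicityP htau J;
  [by []..|move=> _].
move: s_sorted => /= /andP[l12 _]; exists l1, l2.
by have [] := sP l1; have [] := sP l2; rewrite // !inE eqxx ?orbT.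
Qed.

Lemma multiplicity_ge3 J : (3 <= mult J)%N -> exists l1 l2 l3,
  [/\ l1 < l2, l2 < l3 & forall l, l \in [:: l1; l2; l3] ->
    tau l = J /\ produces A J l].
Proof.
have [[|l1 [|l2 [|l3 s]]] [s_sorted <- sP]] := multiplicityP htau J;
  [by []..|move=> _].
move: s_sorted => /= /and3P[l12 l23 _]; exists l1, l2, l3; split=> // l l_in.
have [|//] := sP l.
by move: l_in; rewrite !inE => /or3P[] ->; rewrite ?orbT.
Qed.

Lemma single_column i j : (1 <= mult [set i]%SET)%N -> i != j -> 0 <= A j i.
Proof. by move=> /multiplicity_ge1[l /produces1P[_]]; exact. Qed.

Lemma pair_sign i j k : uniq [:: i; j; k] -> (2 <= mult [set i; j]%SET)%N ->
  [/\ 0 < A i j, A j i < 0 & A i i < A j j] \/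
  [/\ A i j < 0, 0 < A j i & A j j < A i i].
Proof.
move=> ijk /multiplicity_ge2[l1 [l2 [l12 _ _]]].
move=> /(produces2P ijk)[t1 [t1_gt0 e1 f1 _]].
move=> /(produces2P ijk)[t2 [t2_gt0 e2 f2 _]].
by apply: two_ratios_sign t1_gt0 t2_gt0 _ e1 f1 e2 f2; rewrite lt_eqF.
Qed.

(** Row i lies in the complement of {j, k} and takes a negative value on every positive vector
    supported there. *)
Lemma pair_unsupported i j k : uniq [:: i; j; k] -> A i j < 0 -> A i k < 0 ->
  mult [set j; k]%SET = 0%N.
Proof.
move=> ijk ij ik; apply/eqP; rewrite -leqn0 leqNgt; apply/negP.
have jki := uniq_rot3 ijk.
move=> /multiplicity_ge1[l /(produces2P jki)[t [t_gt0 _ _]]].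
by rewrite leNgt -[0]addr0 ltrD // pmulr_llt0.
Qed.

(** The two singletons make A i j and A j i nonnegative, but two values on the pair need opposite
    strict signs. *)
Lemma pair_of_singles i j k : uniq [:: i; j; k] ->
  (1 <= mult [set i]%SET)%N -> (1 <= mult [set j]%SET)%N ->
  (mult [set i; j]%SET <= 1)%N.
Proof.
move=> ijk mi mj; rewrite leqNgt; apply/negP => /(pair_sign ijk).
have ij : i != j by move: ijk => /=; rewrite inE negb_or; case: (i == j).
have Aji := single_column mi ij.
have Aij : 0 <= A i j by apply: single_column mj _; rewrite eq_sym.
by case=> -[ij_sg ji_sg _]; lra.
Qed.

Lemma single_full_pair i j k : uniq [:: i; j; k] ->
  (1 <= mult [set i]%SET)%N -> (2 <= mult [set i; j]%SET)%N ->
  A i j < 0 /\ 0 < A j i.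
Proof.
move=> ijk mi mij.
have ij : i != j by move: ijk => /=; rewrite inE negb_or; case: (i == j).
have Aji := single_column mi ij.
by case: (pair_sign ijk mij) => -[ij_sg ji_sg _]; lra.
Qed.

Lemma single_full_pairs i j k : uniq [:: i; j; k] ->
  (1 <= mult [set i]%SET)%N -> (2 <= mult [set i; j]%SET)%N ->
  (2 <= mult [set i; k]%SET)%N -> mult [set j; k]%SET = 0%N.
Proof.
move=> ijk mi mij mik.
have ikj := uniq_swap23 ijk.
have [ij _] := single_full_pair ijk mi mij.
have [ik _] := single_full_pair ikj mi mik.
exact: (pair_unsupported ijk).
Qed.

(* The signs of the off-diagonal entries orient the pairs according to the
   diagonal, and the row of the largest diagonal entry is then negative. *)
Lemma not_all_full_pairs i j k : uniq [:: i; j; k] ->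
  (2 <= mult [set i; j]%SET)%N -> (2 <= mult [set i; k]%SET)%N ->
  (2 <= mult [set j; k]%SET)%N -> False.
Proof.
move=> ijk mij mik mjk.
have ikj := uniq_swap23 ijk.
have jki := uniq_rot3 ijk.
have jik := uniq_swap12 ijk.
have kij := uniq_rot3 jki.
case: (pair_sign ijk mij) => -[ij ji dij];
case: (pair_sign ikj mik) => -[ik ki dik];
case: (pair_sign jki mjk) => -[jk kj djk]; try by lra.
- by move: mij; rewrite (pair_unsupported kij).
- by move: mik; rewrite (pair_unsupported jik).
- by move: mik; rewrite (pair_unsupported jik).
- by move: mij; rewrite (pair_unsupported kij).
- by move: mjk; rewrite (pair_unsupported ijk).
- by move: mjk; rewrite (pair_unsupported ijk).
Qed.

(** The complementary row j bounds both ratios t1, t2 of the pair {i, k} by [m]. They are the roots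
    of a quadratic with leading coefficient A i k < 0, and its sign at [m] is the weak inequality.
    Equality means that [m] is one of the ratios; then [al] is one of the two values assigned to {i,
    k}. *)
Lemma full_pair_bound i j k : uniq [:: i; j; k] ->
  A j k < 0 -> A i k < 0 -> (2 <= mult [set i; k]%SET)%N ->
  let m := A j i / - A j k in let al := A i i + A i k * m in
  m * (al - A k k) <= A k i /\
  (m * (al - A k k) < A k i \/ tau al = [set i; k]%SET).
Proof.
move=> ijk jk ik /multiplicity_ge2[l1 [l2 [l12 tau1 tau2]]] + + m al.
have ikj := uniq_swap23 ijk.
move=> /(produces2P ikj)[t1 [t1_gt0 e1 f1 c1]].
move=> /(produces2P ikj)[t2 [t2_gt0 e2 f2 c2]].
have tm t : 0 <= A j i + A j k * t -> t <= m.
  by rewrite /m ler_pdivlMr ?oppr_gt0 // mulrN lerNl; lra.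
have [_ sE pE] : [/\ A i k != 0, A i k * (t1 + t2) = A k k - A i i &
    A i k * (t1 * t2) = - A k i].
  by apply: two_ratios t1_gt0 t2_gt0 _ e1 f1 e2 f2; rewrite lt_eqF.
have dE : A k i - m * (al - A k k) = - A i k * ((m - t1) * (m - t2)).
  by have := congr1 ( *%R m) sE; rewrite /al /=; move: (m) pE => m'; lra.
rewrite -subr_ge0 -subr_gt0 dE.
have := tm _ c1; rewrite -subr_ge0 le0r => h1.
have := tm _ c2; rewrite -subr_ge0 le0r => h2.
have ik0 : 0 < - A i k by rewrite oppr_gt0.
case/orP: h1 => [/eqP h1|h1].
  rewrite h1 mul0r mulr0; split=> //; right.
  by rewrite /al; move/subr0_eq: h1 => ->; rewrite e1.
case/orP: h2 => [/eqP h2|h2].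
  rewrite h2 !mulr0; split=> //; right.
  by rewrite /al; move/subr0_eq: h2 => ->; rewrite e2.
by split; [rewrite ltW // | left]; rewrite !mulr_gt0.
Qed.

(** The parameters are chosen so that q n = A i j and s m = A j i; thus m and al are those of
    [full_pair_bound], and n and be are their analogues with i and j exchanged. *)
Lemma produces3_eigen_data i j k l : uniq [:: i; j; k] ->
  A i k < 0 -> A j k < 0 -> produces A [set: 'I_3]%SET l ->
  eigen_data (A i i + A i k * (A j i / - A j k))
    (A j j + A j k * (A i j / - A i k)) (- A i k) (- A j k)
    (A j i / - A j k) (A i j / - A i k) (A k i) (A k j) (A k k) l.
Proof.
move=> ijk ik jk /(produces3P ijk)[x [y [x0 y0 e1 e2 e3]]].
have ik0 : A i k != 0 by rewrite lt_eqF.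
have jk0 : A j k != 0 by rewrite lt_eqF.
exists x, y; split=> //; last by rewrite -e3; ring.
- have -> : A i i = (l * x - A i j * y - A i k) / x.
    by rewrite -e1; field; rewrite gt_eqF.
  by field; rewrite ik0 jk0 gt_eqF.
- have -> : A j j = (l * y - A j i * x - A j k) / y.
    by rewrite -e2; field; rewrite gt_eqF.
  by field; rewrite ik0 jk0 gt_eqF.
Qed.

Lemma two_full_pairs i j k : uniq [:: i; j; k] ->
  (1 <= mult [set i]%SET)%N -> (1 <= mult [set j]%SET)%N ->
  (2 <= mult [set i; k]%SET)%N -> (2 <= mult [set j; k]%SET)%N ->
  (mult [set: 'I_3]%SET <= 2)%N.
Proof.
move=> ijk mi mj mik mjk; rewrite leqNgt; apply/negP.
have ikj := uniq_swap23 ijk.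
have jki := uniq_rot3 ijk.
have jik := uniq_swap12 ijk.
have [ik _] := single_full_pair ikj mi mik.
have [jk _] := single_full_pair jki mj mjk.
have [bi si] := full_pair_bound ijk jk ik mik.
have [bj _] := full_pair_bound jik ik jk mjk.
move=> /multiplicity_ge3[l1 [l2 [l3 [l12 l23 lP]]]].
have data l : l \in [:: l1; l2; l3] -> _ :=
  fun l_in => produces3_eigen_data ijk ik jk (lP l l_in).2.
have q0 : 0 < - A i k by rewrite oppr_gt0.
have s0 : 0 < - A j k by rewrite oppr_gt0.
apply: (no_three_eigen_data q0 s0 l12 l23 _ _ _ bi bj).
- by apply: data; rewrite !inE ?eqxx ?orbT.
- by apply: data; rewrite !inE ?eqxx ?orbT.
- by apply: data; rewrite !inE ?eqxx ?orbT.
(* If [tau al] is {i, k}, then al is not among the three values, which [tau] sends to the full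
   support. *)
case: si => [si|si]; [by left | right; apply/negP => /lP[]].
rewrite si => /setP/(_ j); rewrite !inE => /orP[] /eqP E.
  by move: jik; rewrite E cons_uniq mem_head.
by move: jki; rewrite E cons_uniq mem_head.
Qed.

(** Three singletons make all off-diagonal entries nonnegative, and such a matrix has at most one
    eigenvalue with a positive eigenvector. *)
Lemma all_singles : (forall i, (1 <= mult [set i]%SET)%N) ->
  (mult [set: 'I_3]%SET <= 1)%N.
Proof.
move=> m1; rewrite leqNgt; apply/negP.
move=> /multiplicity_ge2[l1 [l2 [l12 _ _]]].
move=> /producesP[x [x_gt0 eigx _]] /producesP[y [y_gt0 eigy _]].
suff : l2 <= l1 by rewrite leNgt l12.
apply: (@metzler_eigenvalue_le _ _ A x y l1 l2 ord0) => [i j ij|i|i|i|i].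
- by apply: single_column => //; rewrite eq_sym.
- by apply: x_gt0; rewrite inE.
- by apply: y_gt0; rewrite inE.
- by rewrite -eigx ?inE //; apply: eq_bigl => j; rewrite inE.
- by rewrite -eigy ?inE //; apply: eq_bigl => j; rewrite inE.
Qed.

End OrderThree.

Lemma size_le_card (T : choiceType) (S : set T) (s : seq T) (c : nat) :
  uniq s -> (forall x, x \in s -> S x) -> (S #<= `I_c)%card -> (size s <= c)%N.
Proof.
move=> s_uniq sS Sc.
have sub : ([set` s] `<=` S)%classic by move=> x /= /sS.
have := geq_card_fset_set (card_le_trans (subset_card_le sub) Sc).
suff -> : fset_set [set` s]%classic = [fset x in s]%fset.
  by rewrite card_imfset //= undup_id.
apply/fsetP => x; rewrite in_fset_set; last exact: finite_seq.
by rewrite !inE; apply/idP/idP => [/set_mem|xs]; rewrite ?inE.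
Qed.

(** * A matrix with nine Pareto eigenvalues *)

Section Example.
Local Open Scope ring_scope.
Variable R : realType.

(** The eigenvectors supplied below use each of {1}, {3}, {1,3} once and each of {1,2}, {2,3},
    {1,2,3} twice, which is the third profile up to a permutation. *)
Let M : 'M[R]_3 := \matrix_(i, j) nth 0 (nth [::]
  [:: [:: 0; -1; 11]; [:: 64; -20; 20]; [:: 19; -1; -8]] i) j.

Let pareto_col3 (a b c l : R) : 0 <= a -> 0 <= b -> 0 <= c -> 0 < a + b + c ->
  0 <= - b + 11 * c - l * a -> 0 <= 64 * a - 20 * b + 20 * c - l * b ->
  0 <= 19 * a - b - 8 * c - l * c ->
  a * (- b + 11 * c - l * a) + b * (64 * a - 20 * b + 20 * c - l * b)
    + c * (19 * a - b - 8 * c - l * c) = 0 -> pareto_spectrum M l.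
Proof.
move=> a0 b0 c0 abc0 y1 y2 y3 orth.
pose x : 'cV[R]_3 := \col_i nth 0 [:: a; b; c] i.
pose y := [:: - b + 11 * c - l * a; 64 * a - 20 * b + 20 * c - l * b;
  19 * a - b - 8 * c - l * c].
have yE i : (M *m x - l *: x) i 0 = nth 0 y i.
  rewrite !mxE !big_ord_recl big_ord0 !mxE /=.
  by case: i => [[|[|[|//]]] ?] /=; ring.
exists x; split.
- apply/eqP => /matrixP x0; move: abc0.
  have := x0 (inord 0) 0; have := x0 (inord 1) 0; have := x0 (inord 2) 0.
  by rewrite !mxE !inordK //= => -> -> ->; rewrite !addr0 ltxx.
- by case=> [[|[|[|//]]] ?]; rewrite mxE.
- by move=> i; rewrite yE; case: i => [[|[|[|//]]] ?].
- under eq_bigr do rewrite yE mxE.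
  by apply: etrans orth; rewrite !big_ord_recl big_ord0 /=; ring.
Qed.

Lemma pareto_capacity3_ge9 c : is_pareto_capacity R 3 c -> (9 <= c)%N.
Proof.
move=> [_ /(_ M)]; pose s : seq R := [:: -18; -17; -16; -10; -8; -4; 0; 8; 11].
apply: (@size_le_card _ _ s).
  apply: lt_sorted_uniq; rewrite /= andbT.
  by do 7 (apply/andP; split; first by lra); lra.
move=> l; rewrite !inE => /or4P[/eqP->|/eqP->|/eqP->|].
- by apply: (@pareto_col3 0 10 1); lra.
- by apply: (@pareto_col3 1 28 1); lra.
- by apply: (@pareto_col3 1 16 0); lra.
move=> /or4P[/eqP->|/eqP->|/eqP->|/or3P[]/eqP->].
- by apply: (@pareto_col3 0 2 1); lra.
- by apply: (@pareto_col3 0 0 1); lra.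
- by apply: (@pareto_col3 1 4 0); lra.
- by apply: (@pareto_col3 1 0 0); lra.
- by apply: (@pareto_col3 1 3 1); lra.
- by apply: (@pareto_col3 1 0 1); lra.
Qed.

End Example.

(** * Sums over supports, split by cardinality *)

Section SupportSums.
Variable (m : {set 'I_3} -> nat).

Lemma setC1_3 (i j k : 'I_3) : uniq [:: i; j; k] ->
  (~: [set k] = [set i; j])%SET.
Proof.
move=> ijk; apply/setP => x; have := mem_index_enum x.
rewrite (perm_mem (index_enum3 ijk)) !inE.
move: ijk; rewrite /= !inE negb_or andbT => /andP[/andP[ij ik] jk].
have ki : k != i by rewrite eq_sym.
have kj : k != j by rewrite eq_sym.
by case/or3P => /eqP ->; rewrite ?eqxx ?orbT ?ik ?jk ?(negPf ki) ?(negPf kj).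
Qed.

Lemma sum_card1 (i j k : 'I_3) : uniq [:: i; j; k] ->
  \sum_(J : {set 'I_3} | #|J| == 1) m J = m [set i] + m [set j] + m [set k].
Proof.
move=> ijk; rewrite -addnA -(big_ord3 _ (fun x => m [set x]) ijk).
rewrite -(big_imset _ (in2W set1_inj)); apply: eq_bigl => J.
apply/cards1P/imsetP => [[x ->]|[x _ ->]]; by exists x.
Qed.

Lemma sum_card2 (i j k : 'I_3) : uniq [:: i; j; k] ->
  \sum_(J : {set 'I_3} | #|J| == 2) m J =
  m [set i; j] + m [set i; k] + m [set j; k].
Proof.
move=> ijk.
have ikj := uniq_swap23 ijk.
have jki := uniq_rot3 ijk.
(* In order three the pairs are the complements of the singletons. *)
rewrite (reindex_inj (inv_inj (@finset.setCK _))) /=.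
rewrite -(setC1_3 ijk) -(setC1_3 ikj) -(setC1_3 jki) -addnA.
rewrite -(big_ord3 _ (fun x => m (~: [set x]))) ?rev_uniq; last first.
  by rewrite -rev_uniq.
rewrite -(big_imset (fun J => m (~: J)) (in2W set1_inj)); apply: eq_bigl => J.
have -> : (#|~: J| == 2) = (#|J| == 1).
  by have := cardsC J; rewrite card_ord; lia.
apply/cards1P/imsetP => [[x ->]|[x _ ->]]; by exists x.
Qed.

Lemma sum_card3 : \sum_(J : {set 'I_3} | #|J| == 3) m J = m [set: 'I_3]%SET.
Proof.
apply: big_pred1 => J /=; rewrite eqEcard finset.subsetT cardsT card_ord /=.
by have := max_card (mem J); rewrite card_ord eqn_leq => ->.
Qed.

Lemma sum_by_card : m finset.set0 = 0 -> \sum_J m J =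
  \sum_(J : {set 'I_3} | #|J| == 1) m J + \sum_(J : {set 'I_3} | #|J| == 2) m J
  + \sum_(J : {set 'I_3} | #|J| == 3) m J.
Proof.
pose card4 (J : {set 'I_3}) : 'I_4 := inord #|J|.
move=> m0; rewrite (partition_big card4 xpredT) //= /card4.
rewrite !big_ord_recl big_ord0 /= addn0 (big_pred1 finset.set0); last first.
  move=> J /=; rewrite -cards_eq0 -val_eqE /= inordK //.
  by rewrite ltnS (leq_trans (max_card _)) ?card_ord.
rewrite m0 add0n addnA; congr (_ + _ + _); apply: eq_bigl => J;
  by rewrite -val_eqE /= inordK // ltnS (leq_trans (max_card _)) ?card_ord.
Qed.

End SupportSums.

(** * Enumeration of the profiles of total at least nine *)

Section Profiles.
Variables (R : realType) (A : 'M[R]_3) (tau : R -> {set 'I_3}).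
Hypothesis htau : assigned_support_map A tau.
Local Notation m := (multiplicity A tau).

Lemma multiplicity_total (c : nat) (i j k : 'I_3) : uniq [:: i; j; k] ->
  (pareto_spectrum A #= `I_c)%card ->
  m [set i]%SET + m [set j]%SET + m [set k]%SET +
  (m [set i; j]%SET + m [set i; k]%SET + m [set j; k]%SET) +
  m [set: 'I_3]%SET = c.
Proof.
move=> ijk /(sum_multiplicity tau) <-.
rewrite -(sum_card1 m ijk) -(sum_card2 m ijk) -(sum_card3 m) sum_by_card //.
apply/eqP; rewrite -leqn0.
by have := multiplicity_le htau finset.set0; rewrite cards0.
Qed.

Lemma multiplicity_pair_le (i j : 'I_3) : m [set i; j]%SET <= 2.
Proof.
by rewrite (leq_trans (multiplicity_le htau _)) // cards2; case: (i != j).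
Qed.

Lemma multiplicity_full_le : m [set: 'I_3]%SET <= 3.
Proof.
by have := multiplicity_le htau [set: 'I_3]%SET; rewrite cardsT card_ord.
Qed.

(** The three profiles agree on m_i, m_k, m_ij and m_ik; the disjunction lists the remaining entries
    in the order of the theorem. *)
Let G (i j k : 'I_3) : Prop :=
  m [set i]%SET = 1 /\ m [set k]%SET = 0 /\
  m [set i; j]%SET = 1 /\ m [set i; k]%SET = 2 /\
  (m [set j]%SET = 0 /\ m [set j; k]%SET = 2 /\ m [set: 'I_3]%SET = 3 \/
   m [set j]%SET = 1 /\ m [set j; k]%SET = 1 /\ m [set: 'I_3]%SET = 3 \/
   m [set j]%SET = 1 /\ m [set j; k]%SET = 2 /\ m [set: 'I_3]%SET = 2).

Hypothesis total_ge9 : forall i j k : 'I_3, uniq [:: i; j; k] ->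
  9 <= m [set i]%SET + m [set j]%SET + m [set k]%SET +
  (m [set i; j]%SET + m [set i; k]%SET + m [set j; k]%SET) +
  m [set: 'I_3]%SET.

Lemma profile_of_single (i j k : 'I_3) : uniq [:: i; j; k] ->
  1 <= m [set i]%SET -> m [set k]%SET <= m [set j]%SET ->
  G i j k \/ G j i k \/ G i k j.
Proof.
move=> ijk mi mkj.
have ikj := uniq_swap23 ijk.
have b1 x : m [set x]%SET <= 1.
  by have := multiplicity_le htau [set x]%SET; rewrite cards1.
have b2 := multiplicity_pair_le; have b3 := multiplicity_full_le.
have tot := total_ge9 ijk.
have ij1 := pair_of_singles htau ijk mi.
have ik1 := pair_of_singles htau ikj mi.
have pairs := single_full_pairs htau ijk mi.
have tri := two_full_pairs htau ijk mi.
have all1 : 1 <= m [set j]%SET -> 1 <= m [set k]%SET -> m [set: 'I_3]%SET <= 1.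
  move=> mj mk; apply: (all_singles htau) => x; have := mem_index_enum x.
  by rewrite (perm_mem (index_enum3 ijk)) !inE => /or3P[]/eqP->.
rewrite /G ![[set j; i]%SET]finset.setUC ![[set k; j]%SET]finset.setUC.
have := b1 i; have := b1 j; have := b1 k.
have := b2 i j; have := b2 i k; have := b2 j k.
move: (m [set i]%SET) (m [set j]%SET) (m [set k]%SET) (m [set i; j]%SET)
  (m [set i; k]%SET) (m [set j; k]%SET) (m [set: 'I_3]%SET)
  mi mkj b3 tot ij1 ik1 pairs tri all1 => m1 m2 m3 m12 m13 m23 m123.
move=> mi mkj b3 tot ij1 ik1 pairs tri all1 c23 c13 c12 c3 c2 c1.
(* If m2 = m3 = 0, the pairs contribute at least 5. Since m12 = m13 = 2 would force m23 = 0, exactly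
   one of m12, m13 is 1, and m23 = 2, m123 = 3. *)
have [m2_0|m2_1] : m2 = 0 \/ m2 = 1 by lia.
  have m3_0 : m3 = 0 by lia.
  have [[E1 E2]|[E1 E2]] : m12 = 1 /\ m13 = 2 \/ m12 = 2 /\ m13 = 1 by lia.
    by left; lia.
  by right; right; lia.
(* A third singleton would cap the total at 3 + (1 + 1 + 2) + 1 = 8. Next, m12 = 0 would need m13 =
   m23 = 2 and m123 = 3, which [tri] forbids. *)
have m3_0 : m3 = 0 by lia.
have m12_1 : m12 = 1 by lia.
have {tri} m123_le : m13 <= 1 \/ m23 <= 1 \/ m123 <= 2 by lia.
have [[E1 E2]|[[E1 E2]|[E1 E2]]] : m13 = 2 /\ m23 = 1 \/ m13 = 1 /\ m23 = 2 \/
    m13 = 2 /\ m23 = 2 by lia.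
- by left; lia.
- by right; left; lia.
- by left; lia.
Qed.

Lemma profile_exists : exists i j k : 'I_3, uniq [:: i; j; k] /\ G i j k.
Proof.
have ord3 (x : 'I_3) : exists y z, uniq [:: x; y; z].
  by exists (x + 1)%R, (x + 2)%R; case: x => [[|[|[|]]]].
(* Without singletons only 2 + 2 + 2 + 3 reaches 9, and three full pairs are impossible. *)
have [x mx] : exists x, 1 <= m [set x]%SET.
  have [w [y [z ijk]]] : exists w y z : 'I_3, uniq [:: w; y; z].
    by exists ord0; exact: ord3.
  have b2 := multiplicity_pair_le; have b3 := multiplicity_full_le.
  apply: contrapT => /forallNP m0.
  have {}m0 r : m [set r]%SET = 0.
    by apply/eqP; rewrite -leqn0 leqNgt; apply/negP/m0.
  have := total_ge9 ijk; rewrite !m0 => tot.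
  have := not_all_full_pairs htau ijk.
  have := b2 w y; have := b2 w z; have := b2 y z.
  move: (m [set w; y]%SET) (m [set w; z]%SET) (m [set y; z]%SET)
    (m [set: 'I_3]%SET) tot b3 => m12 m13 m23 m123 tot b3 c23 c13 c12.
  by apply; lia.
have [y [z xyz]] := ord3 x.
have xzy := uniq_swap23 xyz.
have [r [t [xrt mrt]]] : exists r t, uniq [:: x; r; t] /\
    m [set t]%SET <= m [set r]%SET.
  by case/orP: (leq_total (m [set z]%SET) (m [set y]%SET)) => ?;
    [exists y, z|exists z, y].
have [?|[?|?]] := profile_of_single xrt mx mrt.
- by exists x, r, t.
- by exists r, x, t; split=> //; exact: uniq_swap12.
- by exists x, t, r; split=> //; exact: uniq_swap23.
Qed.

End Profiles.

Lemma exists_perm3 (i j k : 'I_3) : uniq [:: i; j; k] ->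
  exists s : 'S_3, [/\ s (inord 0) = i, s (inord 1) = j & s (inord 2) = k].
Proof.
move=> ijk; pose f (x : 'I_3) := nth i [:: i; j; k] x.
have f_inj : injective f.
  by move=> x y /eqP; rewrite nth_uniq // => /eqP/val_inj.
by exists (perm f_inj); rewrite !permE /f !inordK.
Qed.

Theorem theorem5p1 (R : realType) (A : 'M[R]_3) (tau : R -> {set 'I_3})
    (hA : full_capacity A) (htau : assigned_support_map A tau) :
  exists sigma : 'S_3,
    [\/ aggregate_profile A tau = (1, 5, 3) /\
        detailed_profile A tau sigma = ((1, 0, 0), (1, 2, 2), 3),
        aggregate_profile A tau = (2, 4, 3) /\
        detailed_profile A tau sigma = ((1, 1, 0), (1, 2, 1), 3) |
        aggregate_profile A tau = (2, 5, 2) /\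
        detailed_profile A tau sigma = ((1, 1, 0), (1, 2, 2), 2)].
Proof.
have [c /pareto_capacity3_ge9 c9 Ac] := hA.
have [|i [j [k [ijk [mi [mk [mij [mik cases]]]]]]]] :=
  @profile_exists _ _ _ htau.
  by move=> x y z xyz; rewrite (multiplicity_total htau xyz Ac).
have [s [si sj sk]] := exists_perm3 ijk.
exists s; rewrite /aggregate_profile /level_sum /detailed_profile si sj sk.
rewrite (sum_card1 _ ijk) (sum_card2 _ ijk) (sum_card3 _) mi mk mij mik.
by case: cases => [[-> [-> ->]]|[[-> [-> ->]]|[-> [-> ->]]]];
  [constructor 1|constructor 2|constructor 3].
Qed.
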